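(* The category of frames is rigid: every endo-equivalence $\mathbb{T}$ on the category of frames is naturally isomorphic to the identity functor.
   Context: A frame is a complete lattice satisfying $a\wedge\bigvee_{i\in I}b_i=\bigvee_{i\in I}(a\wedge b_i)$. The arrows of the category of frames are the functions preserving finite meets (including the top element $1$) and arbitrary joins (including the bottom element $0$). An endo-equivalence on a category $\mathcal{C}$ is a functor $\mathbb{T}:\mathcal{C}\to\mathcal{C}$ which is full and faithful and has a full and faithful left adjoint (i.e. an equivalence of categories from $\mathcal{C}$ to itself). A category is called rigid if every endo-equivalence on it is (naturally) isomorphic to the identity functor. *)

(* Defs.v *)
From mathcomp Require Import all_boot.
From mathcomp Require Import boolp classical_sets.

Set Implicit Arguments.
Unset Strict Implicit.
Unset Printing Implicit Defensive.

Local Open Scope classical_set_scope.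

(** * Categories, functors, natural transformations *)

Record category := Category {
  obj :> Type;
  hom : obj -> obj -> Type;
  idm : forall a, hom a a;
  (* [compm g f] is "g after f" *)
  compm : forall a b c, hom b c -> hom a b -> hom a c;
  compm1 : forall a b (f : hom a b), compm f (idm a) = f;
  comp1m : forall a b (f : hom a b), compm (idm b) f = f;
  compmA : forall a b c d (h : hom c d) (g : hom b c) (f : hom a b),
    compm h (compm g f) = compm (compm h g) f
}.

Record functor (C D : category) := Functor {
  fobj :> C -> D;
  fmap : forall a b, hom a b -> hom (fobj a) (fobj b);
  fmap1 : forall a, fmap (idm a) = idm (fobj a);
  fmapM : forall a b c (g : hom b c) (f : hom a b),
    fmap (compm g f) = compm (fmap g) (fmap f)
}.
Arguments fmap {C D} F {a b} f : rename.

Definition id_functor (C : category) : functor C C :=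
  @Functor C C (fun a => a) (fun _ _ f => f)
    (fun _ => erefl) (fun _ _ _ _ _ => erefl).

Section CompFunctor.
Variables (C D E : category) (G : functor D E) (F : functor C D).

Let gf_map (a b : C) (f : hom a b) : hom (G (F a)) (G (F b)) :=
  fmap G (fmap F f).

Fact comp_functor1 (a : C) : gf_map (idm a) = idm (G (F a)).
Proof. by rewrite /gf_map !fmap1. Qed.

Fact comp_functorM (a b c : C) (g : hom b c) (f : hom a b) :
  gf_map (compm g f) = compm (gf_map g) (gf_map f).
Proof. by rewrite /gf_map !fmapM. Qed.

Definition comp_functor : functor C E := Functor comp_functor1 comp_functorM.

End CompFunctor.

Record nat_trans (C D : category) (F G : functor C D) := NatTrans {
  component :> forall a : C, hom (F a) (G a);
  naturality : forall (a b : C) (f : hom a b),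
    compm (component b) (fmap F f) = compm (fmap G f) (component a)
}.

Definition is_iso (C : category) (a b : C) (f : hom a b) : Prop :=
  exists g : hom b a, compm g f = idm a /\ compm f g = idm b.

Definition naturally_isomorphic (C D : category) (F G : functor C D) : Prop :=
  exists alpha : nat_trans F G, forall a : C, is_iso (alpha a).

Definition full (C D : category) (F : functor C D) : Prop :=
  forall (a b : C) (g : hom (F a) (F b)), exists f : hom a b, fmap F f = g.

Definition faithful (C D : category) (F : functor C D) : Prop :=
  forall (a b : C) (f g : hom a b), fmap F f = fmap F g -> f = g.

(* Unit, counit and the two triangle identities. *)
Definition left_adjoint (C D : category) (L : functor C D) (R : functor D C) :
    Prop :=
  exists (eta : nat_trans (id_functor C) (comp_functor R L))
         (eps : nat_trans (comp_functor L R) (id_functor D)),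
    (forall a : C, compm (eps (L a)) (fmap L (eta a)) = idm (L a)) /\
    (forall b : D, compm (fmap R (eps b)) (eta (R b)) = idm (R b)).

Definition endo_equivalence (C : category) (T : functor C C) : Prop :=
  [/\ full T, faithful T &
      exists L : functor C C, [/\ full L, faithful L & left_adjoint L T]].

Definition rigid (C : category) : Prop :=
  forall T : functor C C,
    endo_equivalence T -> naturally_isomorphic T (id_functor C).

(** * Frames *)

(* The order is [Prop]-valued and the carrier is an arbitrary type: the
   structures of [Order] would add a decidable equality and a choice operator
   to the objects. *)
Record completeLattice := CompleteLattice {
  carrier :> Type;
  cle : carrier -> carrier -> Prop;
  cle_refl : forall x, cle x x;
  cle_anti : forall x y, cle x y -> cle y x -> x = y;
  cle_trans : forall y x z, cle x y -> cle y z -> cle x z;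
  Sup : set carrier -> carrier;
  Sup_ub : forall (A : set carrier) x, A x -> cle x (Sup A);
  Sup_le : forall (A : set carrier) y,
    (forall x, A x -> cle x y) -> cle (Sup A) y;
  Inf : set carrier -> carrier;
  Inf_lb : forall (A : set carrier) x, A x -> cle (Inf A) x;
  Inf_ge : forall (A : set carrier) y,
    (forall x, A x -> cle y x) -> cle y (Inf A)
}.

Definition cmeet (L : completeLattice) (x y : L) : L := Inf [set x; y].
Definition ctop (L : completeLattice) : L := Inf set0.

(* A join of a family is the [Sup] of its range, so joins of subsets cover all
   families, whatever the universe of the index type. *)
Record frame := Frame {
  frame_lattice :> completeLattice;
  frame_distr : forall (a : frame_lattice) (B : set frame_lattice),
    cmeet a (Sup B) = Sup (cmeet a @` B)
}.

(* Preservation of the bottom element is the case [A = set0] of [fhom_Sup]. *)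
Record frame_hom (A B : frame) := FrameHom {
  fhom_fun :> A -> B;
  fhom_top : fhom_fun (ctop A) = ctop B;
  fhom_meet : forall x y, fhom_fun (cmeet x y) = cmeet (fhom_fun x) (fhom_fun y);
  fhom_Sup : forall X : set A, fhom_fun (Sup X) = Sup (fhom_fun @` X)
}.

Lemma frame_hom_eq (A B : frame) (f g : frame_hom A B) : f =1 g -> f = g.
Proof.
case: f g => [f f1 fM fS] [g g1 gM gS] /= /funext fg; subst g.
by congr FrameHom; exact: Prop_irrelevance.
Qed.

Definition frame_id (A : frame) : frame_hom A A.
Proof.
exists (fun x => x) => //.
by move=> X; rewrite image_id.
Defined.

Definition frame_comp (A B C : frame) (g : frame_hom B C) (f : frame_hom A B) :
  frame_hom A C.
Proof.
exists (fun x => g (f x)).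
- by rewrite !fhom_top.
- by move=> x y; rewrite !fhom_meet.
- by move=> X; rewrite !fhom_Sup image_comp.
Defined.

Definition Frames : category.
Proof.
by apply: (@Category frame frame_hom frame_id frame_comp) => *;
  exact: frame_hom_eq.
Defined.

(* Main.v *)
Require Import Defs.
From mathcomp Require Import all_boot.
From mathcomp Require Import boolp classical_sets.

Set Implicit Arguments.
Unset Strict Implicit.
Unset Printing Implicit Defensive.

Local Open Scope classical_set_scope.

(** Let T be an endo-equivalence of the category of frames.

    The free frame on one generator is the three-element chain S ([S1]), so the
    elements of A are the homomorphisms from S to A.  The functor T fixes S up
    to isomorphism.  Indeed T S is a separator with at most three
    endomorphisms, the identity and some that factor through T 2, where 2 is
    the initial frame.  Since T S separates, some homomorphism from T S to S
    hits the middle element of S ([image_S1_sgen]); as S is free, it has a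
    section, and the composite endomorphism of T S can only be the identity
    ([image_S1_iso]).  Hence the elements of T A are the homomorphisms from T S
    to T A, that is, from S to A, and this gives bijections psi from A to T A,
    natural in A ([natural_bijection]).

    Transported along psi, the binary meet of T A becomes a natural binary
    operation on the frames A, hence an element c of the free frame on two
    generators.  Since the meet is idempotent and commutative, so is the truth
    table of c, which therefore is that of the conjunction or of the
    disjunction; c is determined by this table, so psi turns all binary meets
    into meets, or all binary joins into meets ([natural_meet]).  In the second
    case each psi would reverse the order, and every frame homomorphism would
    preserve arbitrary meets, because its image under T preserves arbitrary
    joins; this is not so ([not_order_reversing]).  In the first case each psi
    is an order isomorphism, so a frame isomorphism
    ([natural_bijection_iso]). *)

(** * Adjoint equivalences and natural isomorphisms *)

(** As L is full, the counit at L a is L k for some k; the triangle identities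
    say that k is inverse to the unit at a. *)
Lemma unit_is_iso (C : category) (L T : functor C C)
    (eta : nat_trans (id_functor C) (comp_functor T L))
    (eps : nat_trans (comp_functor L T) (id_functor C)) :
  full L -> faithful L ->
  (forall a : C, compm (eps (L a)) (fmap L (eta a)) = idm (L a)) ->
  (forall b : C, compm (fmap T (eps b)) (eta (T b)) = idm (T b)) ->
  forall a : C, is_iso (eta a).
Proof.
move=> fullL faithL tri1 tri2 a.
have [k Lk] := fullL _ _ (eps (L a)).
exists k; split.
  by apply: faithL; rewrite fmapM Lk tri1 fmap1.
by have /= -> := naturality eta k; rewrite Lk tri2.
Qed.

Lemma is_iso_mono (C : category) (a b z : C) (m : hom a b) (f g : hom z a) :
  is_iso m -> compm m f = compm m g -> f = g.
Proof.
by case=> n [nm _] mfg; rewrite -(comp1m f) -(comp1m g) -nm -!compmA mfg.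
Qed.

Lemma naturally_isomorphic_sym (C D : category) (F G : functor C D) :
  naturally_isomorphic F G -> naturally_isomorphic G F.
Proof.
case=> alpha isoalpha.
pose inv a := sval (cid (isoalpha a)).
have invl a : compm (inv a) (alpha a) = idm (F a).
  by rewrite /inv; case: cid => g [].
have invr a : compm (alpha a) (inv a) = idm (G a).
  by rewrite /inv; case: cid => g [].
have nat_inv a b (f : hom a b) :
    compm (inv b) (fmap G f) = compm (fmap F f) (inv a).
  rewrite -[LHS]compm1 -invr compmA -(compmA _ (fmap G f)) -naturality.
  by rewrite !compmA invl comp1m.
by exists (NatTrans nat_inv) => a; exists (alpha a).
Qed.

Definition ess_surjective (C D : category) (F : functor C D) : Prop :=
  forall b : D, exists (a : C) (m : hom b (F a)), is_iso m.

Lemma endo_equivalence_ess_surjective (C : category) (T : functor C C) :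
  endo_equivalence T -> ess_surjective T.
Proof.
case=> _ _ [L [fullL faithL [eta [eps [tri1 tri2]]]]] a.
by exists (L a), (eta a); exact: unit_is_iso tri1 tri2 a.
Qed.

Definition separator (C : category) (s : C) : Prop :=
  forall (a b : C) (f g : hom a b),
    (forall h : hom s a, compm f h = compm g h) -> f = g.

Section Images.
Variables (C : category) (T : functor C C).
Hypotheses (fullT : full T) (faithT : faithful T) (esT : ess_surjective T).

Lemma hom_unique_image (i : C) :
  (forall (b : C) (f g : hom i b), f = g) ->
  forall (b : C) (f g : hom (T i) b), f = g.
Proof.
move=> uniq b f g; have [a [m iso_m]] := esT b.
apply: is_iso_mono iso_m _.
have [f' <-] := fullT (compm m f); have [g' <-] := fullT (compm m g).
by rewrite (uniq _ f' g').
Qed.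

(** Up to isomorphism, the arrows f and g below are images under T of arrows
    f' and g', and those are told apart by arrows from s. *)
Lemma separator_image (s : C) : separator s -> separator (T s).
Proof.
move=> sep a b f g fg.
have [a' [m [n [nm mn]]]] := esT a; have [b' [m' iso_m']] := esT b.
suff fgn : compm f n = compm g n.
  by rewrite -(compm1 f) -(compm1 g) -nm !compmA fgn.
apply: is_iso_mono iso_m' _.
have [f' f'E] := fullT (compm m' (compm f n)).
have [g' g'E] := fullT (compm m' (compm g n)).
rewrite -f'E -g'E; congr (fmap T _); apply: sep => h; apply: faithT.
by rewrite !fmapM f'E g'E -!compmA fg.
Qed.

End Images.

(** * Order theory in frames *)

Section Lattice.
Variable A : completeLattice.
Implicit Types a b c : A.

Lemma le_top a : cle a (ctop A).
Proof. exact: Inf_ge. Qed.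

Lemma meet_lel a b : cle (cmeet a b) a.
Proof. by apply: Inf_lb; left. Qed.

Lemma meet_ler a b : cle (cmeet a b) b.
Proof. by apply: Inf_lb; right. Qed.

Lemma le_meet a b c : cle c a -> cle c b -> cle c (cmeet a b).
Proof. by move=> ca cb; apply: Inf_ge => x [] ->. Qed.

Lemma meetC a b : cmeet a b = cmeet b a.
Proof. by rewrite /cmeet setUC. Qed.

Lemma meet_idl a b : cle a b -> cmeet a b = a.
Proof.
move=> ab; apply: cle_anti; first exact: meet_lel.
by apply: le_meet => //; exact: cle_refl.
Qed.

Lemma meetxx a : cmeet a a = a.
Proof. by apply: meet_idl; exact: cle_refl. Qed.

Definition join a b : A := Sup [set a; b].

Lemma le_joinr a b : cle b (join a b).
Proof. by apply: Sup_ub; right. Qed.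

Lemma join_idl a b : cle b a -> join a b = a.
Proof.
move=> ba; apply: cle_anti; last by apply: Sup_ub; left.
by apply: Sup_le => _ [] -> //; exact: cle_refl.
Qed.

Lemma Sup_sub (X Y : set A) : X `<=` Y -> cle (Sup X) (Sup Y).
Proof. by move=> XY; apply: Sup_le => x /XY; exact: Sup_ub. Qed.

End Lattice.

Lemma meet_Sup_le (A : frame) (a c : A) (B : set A) :
  (forall b, B b -> cle (cmeet a b) c) -> cle (cmeet a (Sup B)) c.
Proof.
by move=> aBc; rewrite frame_distr; apply: Sup_le => _ [b Bb <-]; exact: aBc.
Qed.

Lemma fhom_bot (A B : frame) (f : frame_hom A B) : f (Sup set0) = Sup set0.
Proof. by rewrite fhom_Sup image_set0. Qed.

Lemma fhom_join (A B : frame) (f : frame_hom A B) a b :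
  f (join a b) = join (f a) (f b).
Proof. by rewrite /join fhom_Sup image_setU !image_set1. Qed.

Lemma fhom_eqE (A B : frame) (f g : frame_hom A B) : f = g -> f =1 g.
Proof. by move->. Qed.

Lemma frame_compE (A B C : frame) (g : frame_hom B C) (f : frame_hom A B) a :
  frame_comp g f a = g (f a).
Proof. by []. Qed.

(** The operations of a frame are determined by its order, so a bijection that
    preserves and reflects the order is a frame homomorphism. *)
Section OrderIso.
Variables (A B : frame) (f : A -> B) (g : B -> A).
Hypotheses (fg : cancel g f).
Hypothesis f_le : forall x y, cle (f x) (f y) <-> cle x y.

Let le_g x y : cle (f x) y <-> cle x (g y).
Proof. by rewrite -{1}[y]fg. Qed.

Let g_le x y : cle y (f x) <-> cle (g y) x.
Proof. by rewrite -{1}[y]fg. Qed.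

Fact order_iso_top : f (ctop A) = ctop B.
Proof.
by apply: cle_anti; [exact: le_top | apply/g_le; exact: le_top].
Qed.

Fact order_iso_meet x y : f (cmeet x y) = cmeet (f x) (f y).
Proof.
apply: cle_anti.
  by apply: le_meet; apply/f_le; [exact: meet_lel | exact: meet_ler].
by apply/g_le/le_meet; apply/g_le; [exact: meet_lel | exact: meet_ler].
Qed.

Fact order_iso_Sup X : f (Sup X) = Sup (f @` X).
Proof.
apply: cle_anti.
  by apply/le_g/Sup_le => x Xx; apply/le_g/Sup_ub; exists x.
by apply: Sup_le => _ [x Xx <-]; apply/f_le/Sup_ub.
Qed.

Definition order_iso : frame_hom A B :=
  FrameHom order_iso_top order_iso_meet order_iso_Sup.

End OrderIso.

(** * Frames of upward closed sets *)

Section Upsets.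
Variables (X : Type) (R : X -> X -> Prop).

Definition upset := {U : set X | forall x y, R x y -> U x -> U y}.

Definition upset_le (U V : upset) := sval U `<=` sval V.

Lemma upset_anti U V : upset_le U V -> upset_le V U -> U = V.
Proof.
case: U V => [U Uu] [V Vu] /= UV VU; apply: eq_exist.
exact/seteqP.
Qed.

Definition upset_Sup (Z : set upset) : upset.
Proof.
exists [set x | exists2 U, Z U & sval U x] => x y Rxy [U ZU Ux].
by exists U => //; exact: (svalP U) Ux.
Defined.

Definition upset_Inf (Z : set upset) : upset.
Proof.
exists [set x | forall U, Z U -> sval U x] => x y Rxy ZUx U ZU.
by apply: (svalP U) (ZUx U ZU).
Defined.

Definition upset_lattice : completeLattice.
Proof.
apply: (@CompleteLattice upset upset_le _ upset_anti _ upset_Sup _ _ upset_Inf).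
- by move=> U.
- by move=> V U W UV VW; exact: subset_trans VW.
- by move=> Z U ZU x Ux; exists U.
- by move=> Z V ZV x [U ZU]; exact: ZV.
- by move=> Z U ZU x; exact.
- by move=> Z V ZV x Vx U ZU; exact: ZV.
Defined.

Lemma upset_topE x : sval (ctop upset_lattice) x.
Proof. by move=> U []. Qed.

Lemma upset_meetE (U V : upset_lattice) x :
  sval (cmeet U V) x <-> sval U x /\ sval V x.
Proof.
split=> [UVx|[Ux Vx] W [] ->] //.
by split; apply: UVx; [left | right].
Qed.

Definition upsets : frame.
Proof.
apply: (@Frame upset_lattice) => U Z; apply: upset_anti => x.
  move=> /upset_meetE[Ux [V ZV Vx]].
  by exists (cmeet U V); [exists V | exact/upset_meetE].
move=> [_ [V ZV <-] /upset_meetE[Ux Vx]]; apply/upset_meetE; split => //.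
by exists V.
Defined.

(** Every upset is the union of the principal upsets of its elements, so a
    homomorphism from [upsets R] is known once its values a x on these are.
    For the extension by joins to preserve finite meets, it is enough that the
    a x cover the top and that the meet of a x and a y is covered by the a z
    for z above both x and y. *)
Section FlatHom.
Variables (A : frame) (a : X -> A).
Hypothesis a_top : Sup (range a) = ctop A.
Hypothesis a_meet : forall x y,
  cle (cmeet (a x) (a y)) (Sup (a @` [set z | R x z /\ R y z])).

Let ext (U : upsets) : A := Sup (a @` sval U).

Fact flat_hom_top : ext (ctop upsets) = ctop A.
Proof.
apply: cle_anti; first exact: le_top.
by rewrite -a_top; apply/Sup_sub/image_subset => x _; exact: upset_topE.
Qed.

Fact flat_hom_meet U V : ext (cmeet U V) = cmeet (ext U) (ext V).
Proof.
apply: cle_anti.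
  by apply: le_meet; apply/Sup_sub/image_subset => x /upset_meetE[].
apply: meet_Sup_le => _ [y Vy <-]; rewrite meetC.
apply: meet_Sup_le => _ [x Ux <-]; rewrite meetC.
apply: cle_trans (a_meet x y) _; apply/Sup_sub/image_subset => z [Rxz Ryz].
by apply/upset_meetE; split; [exact: (svalP U) Ux | exact: (svalP V) Vy].
Qed.

Fact flat_hom_Sup Z : ext (Sup Z) = Sup (ext @` Z).
Proof.
apply: cle_anti; apply: Sup_le.
  move=> _ [x [U ZU Ux] <-]; apply: cle_trans (Sup_ub _); last by exists U.
  by apply: Sup_ub; exists x.
by move=> _ [U ZU <-]; apply/Sup_sub/image_subset => x Ux; exists U.
Qed.

Definition flat_hom : frame_hom upsets A :=
  FrameHom flat_hom_top flat_hom_meet flat_hom_Sup.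

End FlatHom.

End Upsets.

(** * The two-element frame *)

(** The set of truth values, in the guise of the upsets of a one-point set. *)
Definition two : frame := @upsets unit (fun _ _ => True).

Definition truth (P : Prop) : two.
Proof. by exists [set _ | P]. Defined.

Lemma truth_sval (t : two) : t = truth (sval t tt).
Proof. by apply: upset_anti => -[]. Qed.

Lemma truth1 : truth True = ctop two.
Proof. by apply: upset_anti => // x _; exact: upset_topE. Qed.

Lemma truth0 : truth False = Sup set0.
Proof. by apply: upset_anti => // x [U []]. Qed.

Lemma truth_inj P Q : truth P = truth Q -> P = Q.
Proof. by move/(congr1 (fun t : two => sval t tt)). Qed.

Lemma two_case (t : two) : t = ctop two \/ t = Sup set0.
Proof.
rewrite [t]truth_sval -truth1 -truth0.
by case: (EM (sval t tt)) => [/propT|/propF] ->; [left | right].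
Qed.

Lemma two_hom_unique (A : frame) (f g : frame_hom two A) : f = g.
Proof.
apply: frame_hom_eq => t.
by case: (two_case t) => ->; rewrite ?fhom_top ?fhom_bot.
Qed.

Definition two_hom (A : frame) : frame_hom two A.
Proof.
apply: (@flat_hom _ _ _ (fun=> ctop A)).
  apply: cle_anti; first exact: le_top.
  by apply: Sup_ub; exists tt.
move=> x y; apply: cle_trans (Sup_ub _); last by exists tt.
exact: le_top.
Defined.

Definition eval_at (X : Type) (R : X -> X -> Prop) (x : X) :
  frame_hom (upsets R) two.
Proof.
exists (fun U => truth (sval U x)).
- by apply: upset_anti => y _; exact: upset_topE.
- move=> U V; apply: upset_anti => -[].
    by move=> /upset_meetE ?; exact/upset_meetE.
  by move=> /upset_meetE ?; exact/upset_meetE.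
- move=> Z; apply: upset_anti => -[].
    by move=> [U ZU Ux]; exists (truth (sval U x)) => //; exists U.
  by move=> [_ [U ZU <-] Ux]; exists U.
Defined.

(** * Free frames *)

(** A subset v of I stands for the meet of the generators in v, and a larger
    subset for a smaller meet; an upset of subsets is a join of such meets.
    This is the free frame on I when I is finite; existence of the extensions
    [free_hom] holds for every I. *)
Definition free (I : Type) : frame := @upsets (set I) subset.

Definition gen (I : Type) (i : I) : free I.
Proof. by exists [set v | v i] => v w; exact. Defined.

Definition free_hom (I : Type) (A : frame) (a : I -> A) : frame_hom (free I) A.
Proof.
apply: (@flat_hom _ _ _ (fun v : set I => Inf (a @` v))).
  apply: cle_anti; first exact: le_top.
  by apply: Sup_ub; exists set0 => //; rewrite image_set0.
move=> v w; apply: cle_trans (Sup_ub _); last first.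
  by exists (v `|` w).
apply: Inf_ge => _ [i [vi|wi] <-].
  by apply: cle_trans (meet_lel _ _) _; apply: Inf_lb; exists i.
by apply: cle_trans (meet_ler _ _) _; apply: Inf_lb; exists i.
Defined.

Lemma free_hom_gen (I : Type) (A : frame) (a : I -> A) i :
  free_hom a (gen i) = a i.
Proof.
apply: cle_anti.
  by apply: Sup_le => _ [v vi <-]; apply: Inf_lb; exists i.
apply: cle_trans (Sup_ub _); last by exists [set i].
by rewrite image_set1; apply: Inf_ge => x ->; exact: cle_refl.
Qed.

(** * The free frame on one generator *)

(** The chain bottom < [sgen] < top, by [S1_case]. *)
Definition S1 : frame := free unit.
Definition sgen : S1 := gen tt.

Lemma S1_case (U : S1) : [\/ U = ctop S1, U = sgen | U = Sup set0].
Proof.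
have [U0|U0] := EM (sval U set0).
  apply: Or31; apply: upset_anti => v _; first exact: upset_topE.
  by apply: (svalP U) U0.
have [U1|U1] := EM (sval U setT).
  apply: Or32; apply: upset_anti => v.
    move=> Uv; case: (EM (v tt)) => // vtt; case: U0.
    by apply: (svalP U) Uv => -[].
  by move=> vtt; apply: (svalP U) U1 => -[].
apply: Or33; apply: upset_anti => v; last by move=> [? []].
by move=> Uv; case: U1; exact: (svalP U) Uv.
Qed.

Definition pick_elt (A : frame) (a : A) : frame_hom S1 A :=
  free_hom (fun=> a).

Lemma pick_elt_gen (A : frame) (a : A) : pick_elt a sgen = a.
Proof. exact: free_hom_gen. Qed.

Lemma S1_hom_eq (A : frame) (f g : frame_hom S1 A) : f sgen = g sgen -> f = g.
Proof.
move=> fg; apply: frame_hom_eq => U.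
by case: (S1_case U) => ->; rewrite ?fhom_top ?fhom_bot.
Qed.

(** An endomorphism is determined by the image of [sgen]: the middle element
    gives the identity, and each of the two others is the image of an element of [two]. *)
Lemma S1_endo (e : frame_hom S1 S1) :
  e = frame_id S1 \/ exists t : frame_hom S1 two, e = frame_comp (two_hom S1) t.
Proof.
case: (S1_case (e sgen)) => eE; [right | by left; exact: S1_hom_eq | right].
  exists (pick_elt (ctop two)); apply: S1_hom_eq.
  by rewrite eE frame_compE pick_elt_gen fhom_top.
exists (pick_elt (Sup set0)); apply: S1_hom_eq.
by rewrite eE frame_compE pick_elt_gen fhom_bot.
Qed.

(** Homomorphisms from S1 pick elements. *)
Lemma S1_separator : separator (S1 : Frames).
Proof.
move=> A B f g fg; apply: frame_hom_eq => a.
rewrite -(pick_elt_gen a).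
by have := fhom_eqE (fg (pick_elt a)) sgen.
Qed.

Lemma S1_two_neq : pick_elt (ctop two) <> pick_elt (Sup set0).
Proof.
move=> /fhom_eqE/(_ sgen).
by rewrite !pick_elt_gen -truth1 -truth0 => /truth_inj TF; rewrite -TF.
Qed.

(** * The image of the free frame on one generator *)

Section Equivalence.
Variable T : functor Frames Frames.
Hypotheses (fullT : full T) (faithT : faithful T) (esT : ess_surjective T).

Let F (A : frame) : frame := T A.
Let Fm (A B : frame) (f : frame_hom A B) : frame_hom (F A) (F B) := fmap T f.

Let FmM (A B C : frame) (g : frame_hom B C) (f : frame_hom A B) :
  Fm (frame_comp g f) = frame_comp (Fm g) (Fm f).
Proof. exact: (fmapM T g f). Qed.

(** The two homomorphisms from S1 to [two] agree except on [sgen], and they are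
    told apart by some homomorphism from F S1, a separator. *)
Lemma image_S1_sgen :
  exists f : frame_hom (F S1) S1, exists y, f y = sgen.
Proof.
pose q0 := pick_elt (Sup set0 : two); pose q1 := pick_elt (ctop two).
have [f [y qfy]] : exists f : frame_hom (F S1) S1,
    exists y, q1 (f y) <> q0 (f y).
  apply: contrapT => noy; apply: S1_two_neq.
  apply: (separator_image fullT faithT esT S1_separator) => f.
  apply: frame_hom_eq => y; apply: contrapT => qfy; apply: noy.
  by exists f, y.
exists f, y; move: qfy.
by case: (S1_case (f y)) => -> //; rewrite ?fhom_top ?fhom_bot.
Qed.

(** All homomorphisms from F two to [two] are equal, whereas S1 has two
    distinct ones. *)
Lemma S1_not_through_image_two (r : frame_hom S1 (F two))
  (p : frame_hom (F two) S1) : frame_comp p r <> frame_id S1.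
Proof.
move=> pr; apply: S1_two_neq.
pose q0 := pick_elt (Sup set0 : two); pose q1 := pick_elt (ctop two).
have qp : frame_comp q1 p = frame_comp q0 p.
  exact: (hom_unique_image fullT esT two_hom_unique).
apply: frame_hom_eq => U.
have prU : p (r U) = U := fhom_eqE pr U.
by have := fhom_eqE qp (r U); rewrite /= prU.
Qed.

(** The section g of f sends [sgen] to a preimage y of it.  The endomorphism
    g f of F S1 is the image of some e.  If e factored through [two], then the
    identity f g f g of S1 would factor through F two; so e is the
    identity. *)
Lemma image_S1_iso :
  exists (g : frame_hom S1 (F S1)) (f : frame_hom (F S1) S1),
    cancel g f /\ cancel f g.
Proof.
have [f [y fy]] := image_S1_sgen.
pose g := pick_elt y; exists g, f.
have fg : frame_comp f g = frame_id S1.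
  by apply: S1_hom_eq; rewrite frame_compE pick_elt_gen.
split=> [U|z]; first exact: fhom_eqE fg U.
have [e Fe] : exists e : frame_hom S1 S1, Fm e = frame_comp g f := fullT _.
suff eid : e = frame_id S1.
  have := fhom_eqE Fe z.
  by rewrite eid /Fm (fmap1 T).
have [//|[t et]] := S1_endo e.
case: (@S1_not_through_image_two
  (frame_comp (Fm t) g) (frame_comp f (Fm (two_hom S1)))).
apply: frame_hom_eq => U /=.
have := fhom_eqE Fe (g U).
rewrite et FmM /= => ->.
have fgE V : f (g V) = V := fhom_eqE fg V.
by rewrite !fgE.
Qed.

(** * Natural bijections on elements *)

(** With g an isomorphism from S1 to F S1, the bijection sends the element a,
    seen as a homomorphism from S1 to A, to the element F a g of F A. *)
Lemma natural_bijection :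
  exists psi : forall A : frame, A -> F A,
    (forall A, bijective (psi A)) /\
    (forall (A B : frame) (f : frame_hom A B) a, psi B (f a) = Fm f (psi A a)).
Proof.
have [g [f [gf fg]]] := image_S1_iso.
exists (fun A a => Fm (pick_elt a) (g sgen)); split=> [A|A B h a]; last first.
  have -> : pick_elt (h a) = frame_comp h (pick_elt a).
    by apply: S1_hom_eq; rewrite frame_compE !pick_elt_gen.
  by rewrite FmM.
have inj : injective (fun a : A => Fm (pick_elt a) (g sgen)).
  move=> a b ab.
  have : frame_comp (Fm (pick_elt a)) g = frame_comp (Fm (pick_elt b)) g.
    exact: S1_hom_eq.
  move=> E; rewrite -[a](pick_elt_gen a) -[b](pick_elt_gen b).
  congr (fhom_fun _ sgen); apply: faithT; apply: frame_hom_eq => z.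
  by have := fhom_eqE E (f z); rewrite /= fg.
have surj y : exists a : A, Fm (pick_elt a) (g sgen) = y.
  have [k Fk] : exists k : frame_hom S1 A, Fm k = frame_comp (pick_elt y) f.
    exact: fullT.
  exists (k sgen); have -> : pick_elt (k sgen) = k.
    by apply: S1_hom_eq; rewrite pick_elt_gen.
  by rewrite Fk frame_compE gf pick_elt_gen.
have [phi phiK] := choice surj.
by exists phi => [a|//]; apply: inj.
Qed.

End Equivalence.

(** * Natural bijections are isomorphisms *)

Section NaturalBijection.
Variables (F : frame -> frame).
Variable Fm : forall A B : frame, frame_hom A B -> frame_hom (F A) (F B).
Variable psi : forall A : frame, A -> F A.
Arguments psi {A}.
Hypothesis psi_bij : forall A, bijective (@psi A).
Hypothesis psi_nat :
  forall (A B : frame) (f : frame_hom A B) a, psi (f a) = Fm f (psi a).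

Let psi_inj A : injective (@psi A).
Proof. exact: bij_inj. Qed.

Let psi_surj A (y : F A) : exists a, psi a = y.
Proof. by have [phi _ phiK] := psi_bij A; exists (phi y). Qed.

(** On the generators x, y of the free frame, the meet of psi x and psi y is
    psi c for some c; by naturality the same c describes the meet of psi a and
    psi b for all a and b.  Evaluation at a set v of generators sends c to a
    truth value that depends on those of x and y only: this is the truth table
    of c. *)
Lemma natural_meet :
  (forall (A : frame) (a b : A), psi (cmeet a b) = cmeet (psi a) (psi b)) \/
  (forall (A : frame) (a b : A), psi (join a b) = cmeet (psi a) (psi b)).
Proof.
pose x : free bool := gen true; pose y : free bool := gen false.
have [c cE] := psi_surj (cmeet (psi x) (psi y)).
have push (A : frame) (a b : A)
      (h := free_hom (fun i : bool => if i then a else b)) :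
    psi (h c) = cmeet (psi a) (psi b).
  by rewrite psi_nat cE fhom_meet -!psi_nat !free_hom_gen.
have c_val v :
    psi (truth (sval c v)) =
      cmeet (psi (truth (v true))) (psi (truth (v false))).
  have := psi_nat (eval_at (@subset bool) v) c.
  by rewrite cE fhom_meet -!psi_nat.
(* By idempotence and commutativity, the truth table is known once its value K
   at (True, False) is: K is the top for the disjunction, the bottom for the
   conjunction. *)
have [K] := psi_surj (cmeet (psi (truth True)) (psi (truth False))).
case: (two_case K) => ->; rewrite -?truth0 -?truth1 => KE; [right | left].
  have orE P Q : psi (truth (P \/ Q)) = cmeet (psi (truth P)) (psi (truth Q)).
    by case: (EM P) => [/propT|/propF] ->; case: (EM Q) => [/propT|/propF] ->;
      rewrite ?orB ?meetxx // meetC.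
  move=> A a b; rewrite -push; suff -> : c = join x y.
    by rewrite fhom_join !free_hom_gen.
  have cE' v : sval c v = (v true \/ v false).
    by apply/truth_inj/psi_inj; rewrite c_val orE.
  apply: upset_anti => v; rewrite /= cE'.
    by case=> ?; [exists x | exists y] => //; [left | right].
  by case=> _ [] -> ?; [left | right].
have andE P Q : psi (truth (P /\ Q)) = cmeet (psi (truth P)) (psi (truth Q)).
  by case: (EM P) => [/propT|/propF] ->; case: (EM Q) => [/propT|/propF] ->;
    rewrite ?andB ?meetxx // meetC.
move=> A a b; rewrite -push; suff -> : c = cmeet x y.
  by rewrite fhom_meet !free_hom_gen.
have cE' v : sval c v = (v true /\ v false).
  by apply/truth_inj/psi_inj; rewrite c_val andE.
by apply: upset_anti => v; rewrite /= cE'; [move=> ?; exact/upset_meetE |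
  move/upset_meetE].
Qed.

(** The rays [n, oo) are the nonempty upsets of the natural numbers; their
    meet is empty.  The homomorphism f to [two] that tests nonemptiness sends
    all rays to the top and their meet to the bottom.  If psi reverses the
    order, it turns this meet into a join, which Fm f preserves. *)
Lemma not_order_reversing :
  ~ (forall (A : frame) (a b : A), psi (join a b) = cmeet (psi a) (psi b)).
Proof.
move=> psi_join.
have psi_rev (A : frame) (a b : A) : cle (psi a) (psi b) <-> cle b a.
  split=> [ab|ba].
    have <- : join a b = a by apply: psi_inj; rewrite psi_join meet_idl.
    exact: le_joinr.
  by rewrite -(join_idl ba) psi_join; exact: meet_ler.
pose N := upsets leq.
have @f : frame_hom N two.
  apply: (@flat_hom _ _ _ (fun=> ctop two)).
    apply: cle_anti; first exact: le_top.
    by apply: Sup_ub; exists 0.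
  move=> m n; apply: cle_trans (le_top _) _; apply: Sup_ub.
  by exists (maxn m n) => //; split; [exact: leq_maxl | exact: leq_maxr].
have @ray (n : nat) : N.
  by exists [set m | n <= m] => m p mp nm; exact: leq_trans mp.
have f_ray n : f (ray n) = ctop two.
  apply: cle_anti; first exact: le_top.
  by apply: Sup_ub; exists n => //=.
(* As psi reverses the order, w is the meet of the rays. *)
have [w wE] := psi_surj (Sup (range (fun n => psi (ray n)))).
have w0 : w = Sup set0.
  apply: upset_anti => [n wn|n [? []]].
  suff : cle w (ray n.+1) by move=> /(_ _ wn) /=; rewrite ltnn.
  by apply/psi_rev; rewrite wE; apply: Sup_ub; exists n.+1.
have : cle (psi (f w)) (psi (ctop two)).
  rewrite psi_nat wE fhom_Sup; apply: Sup_le => _ [_ [n _ <-] <-].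
  by rewrite -psi_nat f_ray; exact: cle_refl.
by move=> /psi_rev; rewrite w0 fhom_bot -truth0 -truth1 => /(_ tt I).
Qed.

Lemma natural_bijection_iso :
  exists psi' : forall A : frame, frame_hom A (F A),
    forall A, psi' A =1 @psi A /\ exists phi : frame_hom (F A) A,
      cancel (psi' A) phi /\ cancel phi (psi' A).
Proof.
have [psi_meet|/not_order_reversing //] := natural_meet.
have psi_le (A : frame) (a b : A) : cle (psi a) (psi b) <-> cle a b.
  split=> ab.
    have <- : cmeet a b = a by apply: psi_inj; rewrite psi_meet meet_idl.
    exact: meet_ler.
  by rewrite -(meet_idl ab) psi_meet; exact: meet_ler.
have phi_ex (A : frame) :
    exists phi : F A -> A, cancel (@psi A) phi /\ cancel phi (@psi A).
  by have [phi] := psi_bij A; exists phi.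
pose phi (A : frame) := sval (cid (phi_ex A)).
have psiK A : cancel (@psi A) (phi A) by rewrite /phi; case: cid => ? [].
have phiK A : cancel (phi A) (@psi A) by rewrite /phi; case: cid => ? [].
have phi_le (A : frame) (y z : F A) : cle (phi A y) (phi A z) <-> cle y z.
  by rewrite -psi_le !phiK.
exists (fun A => order_iso (@phiK A) (@psi_le A)) => A; split=> //.
by exists (order_iso (@psiK A) (@phi_le A)).
Qed.

End NaturalBijection.

Theorem mainTheorem1 : rigid Frames.
Proof.
move=> T eqT; have esT := endo_equivalence_ess_surjective eqT.
case: eqT => fullT faithT _; apply: naturally_isomorphic_sym.
have [psi [psi_bij psi_nat]] := natural_bijection fullT faithT esT.
have [psi' psi'P] := natural_bijection_iso psi_bij psi_nat.
have psi'E A : psi' A =1 psi A by have [] := psi'P A.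
have nat_psi' (A B : frame) (f : frame_hom A B) :
    frame_comp (psi' B) f = frame_comp (fmap T f : frame_hom _ _) (psi' A).
  by apply: frame_hom_eq => a; rewrite !frame_compE !psi'E psi_nat.
pose alpha := @NatTrans _ _ (id_functor Frames) T psi' nat_psi'.
exists alpha => A; have [_ [phi [psiK phiK]]] := psi'P A.
by exists phi; split; apply: frame_hom_eq => x /=; rewrite ?psiK ?phiK.
Qed.
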